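(* Let $g:E\to\overline{\mathbb{R}}$ be any function. Then $g=B_\omega B_\omega^\circ g$ if, and only if, either $g\equiv+\infty$, or $g\equiv-\infty$, or $g\in\mathrm{Lip}_\omega(E)$. In that case, we have $B_\omega^\circ g=-g$.
   Context: $\overline{\mathbb{R}}=\mathbb{R}\cup\{\pm\infty\}$. $E$ is a Hausdorff (real) topological vector space and $\omega:E\to[0,+\infty)$ is a continuous subadditive map ($\omega(x+y)\leq\omega(x)+\omega(y)$ for all $x,y\in E$) such that $\omega(-x)=\omega(x)$ for all $x\in E$, and $\omega(x)=0\iff x=0$. A function $f:E\to\mathbb{R}$ is $\omega$-Lipschitz continuous if $|f(y)-f(x)|\leq\omega(y-x)$ for all $x,y\in E$; $\mathrm{Lip}_\omega(E)$ is the set of such functions. $B_\omega$ and $B_\omega^\circ$ are the Moreau conjugacies with kernel $-\omega(y-x)$: for $f:E\to\overline{\mathbb{R}}$ l.s.c., $B_\omega f(x)=\sup_{y\in E}(-\omega(y-x)-f(y))$, and for $g:E\to\overline{\mathbb{R}}$ arbitrary, $B_\omega^\circ g(y)=\sup_{x\in E}(-\omega(y-x)-g(x))$ (which is l.s.c.). *)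

(* Defs.v *)
From HB Require Import structures.
From mathcomp Require Import all_boot all_order all_algebra.
From mathcomp Require Import all_classical all_reals all_analysis.
From mathcomp Require Import lra.

Set Implicit Arguments.
Unset Strict Implicit.
Unset Printing Implicit Defensive.

Import Order.TTheory GRing.Theory Num.Theory.
Import numFieldNormedType.Exports.

Local Open Scope classical_set_scope.
Local Open Scope ring_scope.

Definition Lip_omega (R : realType) (E : topologicalLmodType R)
    (omega : E -> R) : set (E -> R) :=
  [set f | forall x y, `|f y - f x| <= omega (y - x)].

(* Since omega is real-valued, no sum of opposite infinities occurs in the
   suprema below. The first conjugacy is meant for lower semicontinuous f;
   see [conj_omega_dual_lsc] for the fact that it may be applied to the values
   of the second one. *)
Definition conj_omega (R : realType) (E : topologicalLmodType R)
    (omega : E -> R) (f : E -> \bar R) (x : E) : \bar R :=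
  ereal_sup [set ((- omega (y - x))%:E - f y)%E | y in [set: E]].

Definition conj_omega_dual (R : realType) (E : topologicalLmodType R)
    (omega : E -> R) (g : E -> \bar R) (y : E) : \bar R :=
  ereal_sup [set ((- omega (y - x))%:E - g x)%E | x in [set: E]].

Lemma conj_omega_dual_lsc (R : realType) (E : topologicalLmodType R)
    (omega : E -> R) (g : E -> \bar R) :
  continuous omega -> lower_semicontinuous (conj_omega_dual omega g).
Proof.
move=> comega y a /ereal_sup_gt[_ [x _ <-]] alt.
suff H : \forall z \near y, (a%:E < (- omega (z - x))%:E - g x)%E.
  exists [set z | (a%:E < (- omega (z - x))%:E - g x)%E] => //= z /= hz.
  by apply: lt_le_trans hz _; apply: ereal_sup_ubound; exists x.
have com : omega (z - x) @[z --> y] --> omega (y - x).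
  apply: (@continuous_comp _ _ _ (fun z => z - x) omega); last exact: comega.
  apply: (@continuous_comp _ _ _ (fun z : E => (z, - x)) (fun p => p.1 + p.2)).
    by apply: cvg_pair; [exact: cvg_id|exact: cvg_cst].
  exact: add_continuous.
case: (g x) alt => [r||] //.
- rewrite -EFinB lte_fin => alt.
  have h : omega (y - x) < - r - a by lra.
  have : \forall z \near y, omega (z - x) < - r - a.
    exact: (cvgr_lt _ com).
  by apply: filterS => z hz; rewrite -EFinB lte_fin; lra.
- by move=> _; apply: nearW => z; rewrite /= ltry.
Qed.

(* Main.v *)
(** Call an extended-real function Lipschitz if [g x <= g y + omega (y - x)]; such
    a function is [+oo], [-oo], or an element of [Lip_omega]. By subadditivity
    every conjugate is Lipschitz in this sense, and the conjugate of a Lipschitz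
    function [f] is [- f], the supremum being attained on the diagonal. *)

Require Import Defs.
From mathcomp Require Import all_boot all_order all_algebra.
From mathcomp Require Import all_classical all_reals all_analysis.
From mathcomp Require Import lra.
Import Order.TTheory GRing.Theory Num.Theory.
Import numFieldNormedType.Exports.
Local Open Scope classical_set_scope.
Local Open Scope ring_scope.

Set Implicit Arguments.
Unset Strict Implicit.

(** The one-sided additive form never adds opposite infinities, [omega] being real; exchanging [x]
    and [y] gives the two-sided bound when [omega] is even. *)
Definition ereal_Lip (R : realType) (E : topologicalLmodType R)
    (omega : E -> R) (f : E -> \bar R) : Prop :=
  forall x y : E, (f x <= f y + (omega (y - x))%:E)%E.

Section OmegaConjugacy.
Context (R : realType) (E : topologicalLmodType R) (omega : E -> R)
  (omega_even : forall x : E, omega (- x) = omega x).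

Lemma omega_distC (x y : E) : omega (x - y) = omega (y - x).
Proof. by rewrite -omega_even opprB. Qed.

(** Evenness makes the kernel symmetric, which leaves a single conjugacy to study. *)
Lemma conj_omega_dualE (f : E -> \bar R) :
  conj_omega_dual omega f = conj_omega omega f.
Proof.
apply/funext => y; rewrite /conj_omega_dual /conj_omega.
by congr ereal_sup; apply: eq_imagel => x _; rewrite omega_distC.
Qed.

(** Negation exchanges [x] and [y], which evenness undoes. This allows the conjugate [- f] to be
    conjugated in turn. *)
Lemma ereal_LipN (f : E -> \bar R) :
  ereal_Lip omega f -> ereal_Lip omega (fun x => - f x)%E.
Proof.
move=> lipf x y; have := lipf y x; rewrite omega_distC.
case: (f x) => [a||]; case: (f y) => [b||] //= fyx;
  rewrite ?addye ?leey ?leNye//.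
by move: fyx; rewrite -!EFinD !lee_fin => ?; lra.
Qed.

Lemma ereal_Lip_conj (omega_subadditive :
    forall x y : E, omega (x + y) <= omega x + omega y) (f : E -> \bar R) :
  ereal_Lip omega (conj_omega omega f).
Proof.
move=> x y; apply: ge_ereal_sup => _ [z _ <-].
rewrite -leeBlDr//.
(* The same index [z] competes in the supremum at [y]; the terms compare by splitting [z - y] as
   [(z - x) + (x - y)]. *)
apply: (@le_trans _ _ ((- omega (z - y))%:E - f z)%E); last first.
  by apply: ereal_sup_ubound; exists z.
have := omega_subadditive (z - x) (x - y).
rewrite addrA subrK (omega_distC x y).
case: (f z) => [a||] //= tri.
by rewrite -EFinD lee_fin; lra.
Qed.

Lemma conj_omega_Lip (omega0 : omega 0 = 0) (f : E -> \bar R) :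
  ereal_Lip omega f -> conj_omega omega f = (fun x => - f x)%E.
Proof.
move=> lipf; apply/funext => x; apply/eqP; rewrite eq_le; apply/andP; split.
  (* No term exceeds [- f x]: this is the Lipschitz bound rearranged. *)
  apply: ge_ereal_sup => _ [y _ <-]; have := lipf x y.
  case: (f x) => [a||]; case: (f y) => [b||] //= fxy;
    rewrite ?addye ?leey ?leNye//.
  by move: fxy; rewrite -!EFinD !lee_fin => ?; lra.
by apply: ereal_sup_ubound; exists x => //; rewrite subrr omega0 oppr0 add0e.
Qed.

Lemma ereal_LipP (f : E -> \bar R) :
  ereal_Lip omega f <->
  [\/ forall x : E, f x = +oo%E,
      forall x : E, f x = -oo%E
    | exists2 h : E -> R, Lip_omega omega h & forall x : E, f x = (h x)%:E].
Proof.
split=> [lipf|[fE|fE|[h liph fE]] x y]; last 3 first.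
- by rewrite !fE.
- by rewrite !fE.
- rewrite !fE -EFinD lee_fin.
  by have := liph x y; rewrite ler_norml => /andP[? _]; lra.
(* As [omega] is finite, an infinite value at one point spreads to all of [E], so the value at [0]
   decides the case. *)
case f0 : (f 0) => [a||].
- have ffin x : f x = (fine (f x))%:E.
    have := lipf x 0; have := lipf 0 x; rewrite f0.
    by case: (f x).
  apply: Or33; exists (fine \o f) => // x y /=.
  have := lipf x y; have := lipf y x.
  rewrite (ffin x) (ffin y) -!EFinD !lee_fin (omega_distC x y) /= => ? ?.
  by rewrite ler_norml; apply/andP; split; lra.
- by apply: Or31 => x; have := lipf 0 x; rewrite f0; case: (f x).
- by apply: Or32 => x; have := lipf x 0; rewrite f0; case: (f x).
Qed.

End OmegaConjugacy.

Theorem proposition6p7 (R : realType) (E : topologicalLmodType R)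
    (E_hausdorff : hausdorff_space E)
    (omega : E -> R)
    (omega_ge0 : forall x : E, 0 <= omega x)
    (omega_continuous : continuous omega)
    (omega_subadditive : forall x y : E, omega (x + y) <= omega x + omega y)
    (omega_even : forall x : E, omega (- x) = omega x)
    (omega_eq0 : forall x : E, omega x = 0 <-> x = 0)
    (g : E -> \bar R) :
  (g = conj_omega omega (conj_omega_dual omega g) <->
     [\/ forall x : E, g x = +oo%E,
         forall x : E, g x = -oo%E
       | exists2 h : E -> R, Lip_omega omega h & forall x : E, g x = (h x)%:E])
  /\
  (g = conj_omega omega (conj_omega_dual omega g) ->
     conj_omega_dual omega g = (fun y : E => (- g y)%E)).
Proof.
have omega0 : omega 0 = 0 by apply/omega_eq0.
rewrite conj_omega_dualE//.
(* A function equal to its biconjugate is itself a conjugate. *)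
have lip_biconj : g = conj_omega omega (conj_omega omega g) -> ereal_Lip omega g.
  by move=> ->; exact: ereal_Lip_conj.
split; last by move=> /lip_biconj; exact: conj_omega_Lip.
rewrite -ereal_LipP//; split=> // lipg.
(* Conjugating once gives [- g], again Lipschitz, so conjugating twice negates twice. *)
rewrite (conj_omega_Lip omega0 lipg) conj_omega_Lip//; last exact: ereal_LipN.
by apply/funext => x; rewrite oppeK.
Qed.
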